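(* A proper submodule $N=n\mathbb{Z}$ of the $\mathbb{Z}$-module $\mathbb{Z}$ is gsdf-absorbing if and only if $n=p^{k}$ with $p$ prime, or $n=2p^{k}$ with $p$ an odd prime, where $k\geq 1$.
   Context: All rings are commutative with identity $1\neq 0$ and all modules are unital. Let $R$ be a ring and $M$ an $R$-module. A proper submodule $N$ of $M$ is called a generalized square-difference factor absorbing submodule (gsdf-absorbing submodule) if for all $u,v\in R$ and $x\in M$, the condition $(u^{2}-v^{2})x\in N$ implies that $(u-v)x\in N$ or $(u+v)^{k}x\in N$ for some positive integer $k$.
   Formalization: The generator n is taken to be a positive integer; the case n = 0 is excluded because the zero submodule is proper and gsdf-absorbing although 0 is neither p^k nor 2p^k. *)

(* Defs.v *)
From HB Require Import structures.
From mathcomp Require Import all_boot all_order all_algebra.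

Set Implicit Arguments.
Unset Strict Implicit.
Unset Printing Implicit Defensive.

Import GRing.Theory.
Local Open Scope ring_scope.

Definition proper_submod (R : comNzRingType) (M : lmodType R)
    (N : submodClosed M) : Prop :=
  exists x : M, x \notin N.

Definition gsdf_absorbing (R : comNzRingType) (M : lmodType R)
    (N : submodClosed M) : Prop :=
  proper_submod N /\
  forall (u v : R) (x : M), (u ^+ 2 - v ^+ 2) *: x \in N ->
    (u - v) *: x \in N \/ exists2 k : nat, (0 < k)%N & (u + v) ^+ k *: x \in N.

(* The ring int as a module over itself is int^o. *)
Definition nZ (n : int) : {pred int^o} := dvdz n.

Fact nZ_subsemimod_closed (n : int) : subsemimod_closed (nZ n).
Proof.
split; first split.
- exact: dvdz0.
- by move=> x y; apply: rpredD.
- by move=> a x nx; apply: dvdz_mull.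
Qed.

HB.instance Definition _ (n : int) :=
  GRing.isSubmodClosed.Build int int^o (nZ n) (nZ_subsemimod_closed n).

(* Main.v *)
Require Import Defs.
From HB Require Import structures.
From mathcomp Require Import all_boot all_order all_algebra.
From mathcomp Require Import ring.

(** Put s = u + v and d = u - v, so that the absorbed element is s d x.
    If p divides s, then a power of s is divisible by p ^ k, and otherwise
    p ^ k divides d x; the factor 2 of 2 p ^ k is harmless because s and d have
    the same parity.  Conversely, if n is not a power of 2, let p be an odd prime factor and
    n = p ^ k b with p not dividing b.  The pair (s, d) = (2 p ^ k, 2 b) forces
    b to be a power of 2, and if 4 divides b then (s, d) = (b / 2, 2 p ^ k)
    violates absorption. *)

Set Implicit Arguments.
Unset Strict Implicit.
Unset Printing Implicit Defensive.

Import GRing.Theory.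

(** The factored form lets Gauss's and Euclid's lemmas act on [u + v], [u - v] and [x]
    separately. *)
Lemma gsdf_absorbing_nZP (n : int) :
  gsdf_absorbing (nZ n) <->
  proper_submod (nZ n) /\
  forall u v x : int, (n %| ((u + v) * (u - v) * x)%R)%Z ->
    (n %| ((u - v) * x)%R)%Z \/
    exists2 k : nat, 0 < k & (n %| ((u + v) ^+ k * x)%R)%Z.
Proof.
have sqrE (u v : int) : ((u + v) * (u - v))%R = (u ^+ 2 - v ^+ 2)%R by ring.
by split=> -[prop_n absn]; split=> // u v x; have := absn u v x; rewrite sqrE.
Qed.

(* The instance u = s + d, v = s - d, x = 1; u + v and u - v must be both even
   or both odd, and doubling two arbitrary numbers ensures this. *)
Lemma gsdf_absorbing_nat (n s d : nat) :
    gsdf_absorbing (nZ n) -> n %| 4 * (s * d) ->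
  n %| 2 * d \/ exists2 k : nat, 0 < k & n %| (2 * s) ^ k.
Proof.
move=> /gsdf_absorbing_nZP[_ absn] n_dv.
have sumE : (s%:Z + d%:Z + (s%:Z - d%:Z) = (2 * s)%N%:Z)%R.
  by rewrite PoszM; ring.
have subE : (s%:Z + d%:Z - (s%:Z - d%:Z) = (2 * d)%N%:Z)%R.
  by rewrite PoszM; ring.
have := absn (s%:Z + d%:Z)%R (s%:Z - d%:Z)%R 1%R.
rewrite !mulr1 sumE subE -PoszM !dvdzE !absz_nat mulnACA.
case=> // [|[k k_gt0]]; first by left.
by rewrite mulr1 dvdzE abszX absz_nat; right; exists k.
Qed.

Lemma prime_power_dvdz_mul (p k : nat) (s y : int) :
    prime p -> ((p ^ k)%N %| (s * y)%R)%Z ->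
  (p %| s)%Z \/ ((p ^ k)%N %| y)%Z.
Proof.
move=> p_pr; have [|p'_s] := boolP (p %| s)%Z; first by left.
rewrite Gauss_dvdzr; first by right.
by rewrite coprimezE /= coprimeXl // prime_coprime.
Qed.

Lemma dvdz_exp2r (p k : nat) (s : int) :
  (p %| s)%Z -> ((p ^ k)%N %| (s ^+ k)%R)%Z.
Proof. by rewrite !dvdzE abszX /= => ps; rewrite dvdn_exp2r. Qed.

Lemma prime_power_gsdf_absorbing (p k : nat) :
    prime p -> 0 < k -> proper_submod (nZ (p ^ k)%N) ->
  gsdf_absorbing (nZ (p ^ k)%N).
Proof.
move=> p_pr k_gt0 prop; apply/gsdf_absorbing_nZP; split=> // u v x.
rewrite -mulrA => /(prime_power_dvdz_mul p_pr)[p_s|]; last by left.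
by right; exists k => //; apply/dvdz_mulr/dvdz_exp2r.
Qed.

Lemma double_prime_power_gsdf_absorbing (p k : nat) :
    prime p -> odd p -> 0 < k -> proper_submod (nZ (2 * p ^ k)%N) ->
  gsdf_absorbing (nZ (2 * p ^ k)%N).
Proof.
move=> p_pr p_odd k_gt0 prop; apply/gsdf_absorbing_nZP; split=> // u v x.
have dv2M (y : int) :
    (Posz (2 * p ^ k)%N %| y)%Z = (2 %| y)%Z && (Posz (p ^ k)%N %| y)%Z.
  by rewrite PoszM Gauss_dvdz // coprimezE coprime2n /= oddX p_odd orbT.
have parity : (2 %| (u - v)%R)%Z = (2 %| (u + v)%R)%Z.
  have -> : (u + v)%R = (u - v + v * 2)%R by ring.
  by rewrite [RHS]rpredDr ?dvdz_mull.
have dv2 (y z : int) : (2 %| (y * z)%R)%Z = (2 %| y)%Z || (2 %| z)%Z.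
  by rewrite !dvdzE abszM Euclid_dvdM.
(* By [parity], evenness of the absorbed product and of [(u - v) * x] become the same condition:
   [u + v] or [x] is even. *)
rewrite !dv2M -mulrA !dv2 parity orbA orbb => /andP[dv2sx].
case/(prime_power_dvdz_mul p_pr) => [p_s|dvp]; last by left; rewrite dv2sx.
right; exists k => //; rewrite dv2M dv2.
rewrite dvdz_mulr ?dvdz_exp2r // andbT.
case/orP: dv2sx => [s2|->]; last exact: orbT.
by rewrite dvdz_exp.
Qed.

Lemma gsdf_absorbing_odd_prime (n p : nat) :
    0 < n -> prime p -> odd p -> p %| n -> gsdf_absorbing (nZ n) ->
  exists2 k : nat, 0 < k & n = p ^ k \/ n = 2 * p ^ k.
Proof.
move=> n_gt0 p_pr p_odd p_n absn.
have [b p'b nE] := pfactor_coprime p_pr n_gt0.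
move: nE; set k := logn p n => nE.
have k_gt0 : 0 < k by rewrite logn_gt0 mem_primes p_pr n_gt0.
have p_gt0 := prime_gt0 p_pr.
have p'2 : coprime p 2 by rewrite coprimen2.
exists k => //.
have bdv : exists j, b %| 2 ^ j.
  (* The first alternative fails, as [p] divides [n] but neither 2 nor [b]; in the second,
     coprimality of [b] and [p] removes the power of [p]. *)
  have [||[j _]] := @gsdf_absorbing_nat n (p ^ k) b absn.
  - by rewrite [p ^ k * b]mulnC -nE dvdn_mull.
  - move=> /(dvdn_trans p_n).
    rewrite Gauss_dvdr // => p_b; move: p'b.
    by rewrite prime_coprime // p_b.
  - rewrite nE expnMn => /(dvdn_trans (dvdn_mulr _ (dvdnn b))).
    rewrite Gauss_dvdl; first by exists j.
    by rewrite -expnM coprimeXr // coprime_sym.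
(* The cases are [b = 1], [b = 2] and [b = 2 ^ (i + 2)]; the last is contradictory. *)
case: bdv => j /(dvdn_pfactor _ _ (isT : prime 2))[[|[|i]] _ bE].
- by left; rewrite nE bE mul1n.
- by right; rewrite nE bE.
(* Here [4 * (2 ^ i * p ^ k)] is exactly [n], while 4 does not divide 2 and the odd [p] divides no
   power of 2. *)
have [||[l _]] := @gsdf_absorbing_nat n (2 ^ i) (p ^ k) absn.
- by rewrite mulnA -(expnD 2 2 i) nE bE.
- by rewrite nE bE dvdn_pmul2r ?expn_gt0 ?p_gt0 // (@dvdn_Pexp2l 2 _ 1).
- move=> /(dvdn_trans p_n); rewrite -expnS -expnM.
  by rewrite Euclid_dvdX // dvdn_prime2 // => /andP[/eqP pE]; rewrite pE in p_odd.
Qed.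

Lemma proper_nZ_neq1 (n : nat) : proper_submod (nZ n) -> n <> 1.
Proof. by move=> [x /negP n'x] nE; apply: n'x; rewrite nE; apply: dvd1z. Qed.

Theorem theorem3p4 (n : nat) (n_gt0 : 0 < n) (nZ_proper : proper_submod (nZ n)) :
  gsdf_absorbing (nZ n) <->
  exists p k : nat,
    1 <= k /\ ((prime p /\ n = p ^ k) \/ (prime p /\ odd p /\ n = 2 * p ^ k)).
Proof.
split=> [absn|[p [k [k_gt0 [[p_pr nE]|[p_pr [p_odd nE]]]]]]]; last 2 first.
- by subst n; apply: prime_power_gsdf_absorbing.
- by subst n; apply: double_prime_power_gsdf_absorbing.
have [n2|] := boolP (2.-nat n).
  exists 2, (logn 2 n); have nE := part_pnat_id n2.
  rewrite p_part in nE; split; last by left.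
  (* Exponent 0 would mean [n = 1], against properness. *)
  rewrite lt0n; apply/eqP => log0; apply: (proper_nZ_neq1 nZ_proper).
  by rewrite -nE log0.
rewrite /pnat n_gt0 -has_predC => /hasP[p].
rewrite mem_primes n_gt0 => /andP[p_pr p_n] p2.
have p_odd : odd p by case: (even_prime p_pr) => // pE; rewrite pE in p2.
have [k k_gt0 nE] := gsdf_absorbing_odd_prime n_gt0 p_pr p_odd p_n absn.
by exists p, k; split=> //; case: nE; [left|right].
Qed.
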